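(* There is a universal constant $c>0$ such that, for every $K\ge2$ and every residual budget $R\ge K$, there exists a blockwise-fair instance with total nonmandatory budget $R$ for which every blockwise-fair policy $\pi$ satisfies $$\sup_{\mu\in[0,1]^K}\mathrm{Reg}^{\pi}_{\mathbf m}(T)\ \ge\ c\sqrt{KR}.$$ Consequently, BDQ-UCB is minimax optimal for blockwise fair regret up to logarithmic factors.
   Context: Bandit: a stochastic $K$-armed bandit with horizon $T$; arm $i\in[K]$ produces independent rewards in $[0,1]$ with mean $\mu_i$; $\mu_\star=\max_i\mu_i$, $i^\star$ is a best arm, $\Delta_i=\mu_\star-\mu_i$; $A_t$ is the arm pulled by the policy at round $t$. Blockwise-fair instance: the horizon $T=\sum_{b=1}^B H_b$ is partitioned into $B$ consecutive blocks, block $b$ of length $H_b$ with integer floor vector $m_b=(m_{b,1},\dots,m_{b,K})\in\mathbb Z_{\ge0}^K$, $\sum_i m_{b,i}\le H_b$. A policy is blockwise fair if $N_{b,i}\ge m_{b,i}$ for every block $b$ and arm $i$, where $N_{b,i}$ counts pulls of arm $i$ inside block $b$. The total nonmandatory (residual) budget is $R=\sum_{b=1}^B(H_b-\sum_i m_{b,i})$. The value of the best blockwise-fair allocation is $\mathrm{OPT}_{\mathbf m}(T)=T\mu_\star-\sum_b\sum_{i\ne i^\star}m_{b,i}\Delta_i$, and the (expected) blockwise fair regret of $\pi$ is $\mathrm{Reg}^\pi_{\mathbf m}(T)=\mathrm{OPT}_{\mathbf m}(T)-\mathbb E_\pi[\sum_{t=1}^T\mu_{A_t}]$. BDQ-UCB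 (failure probability parameter $\eta\in(0,1)$, $L=\log(2KT/\eta)$): in each block $b$, first pull each arm $i$ exactly $m_{b,i}$ times; then in each remaining round of the block pull an arm maximizing $U_i$, where $U_i=+\infty$ if $N_i=0$ and $U_i=\widehat\mu_i+\sqrt{2L/N_i}$ otherwise, with $N_i,\widehat\mu_i$ the total pull count and empirical mean of arm $i$ over all observations so far. *)

(* Defs.v *)
From HB Require Import structures.
From mathcomp Require Import all_boot all_order all_algebra.
From mathcomp Require Import all_classical all_reals all_analysis measurable_realfun.
Set Implicit Arguments.
Unset Strict Implicit.
Unset Printing Implicit Defensive.
Import Order.TTheory GRing.Theory Num.Theory.
Local Open Scope classical_set_scope.
Local Open Scope ring_scope.

Record fair_instance (K : nat) := FairInstance {
  nblocks : nat ;
  block_length : 'I_nblocks -> nat ;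
  floor_req : 'I_nblocks -> 'I_K -> nat ;
  floor_req_le : forall b, (\sum_(i < K) floor_req b i <= block_length b)%N }.

Arguments block_length {K} I b : rename.
Arguments floor_req {K} I b i : rename.

Section Blocks.
Context {K : nat}.
Implicit Type I : fair_instance K.

Definition horizon I : nat := (\sum_(b < nblocks I) block_length I b)%N.

(* Rounds are numbered from 0: block [b] consists of the rounds [t] with
   [block_start I b <= t < block_start I b + block_length I b]. *)
Definition block_start I (b : 'I_(nblocks I)) : nat :=
  (\sum_(b' < nblocks I | (b' < b)%N) block_length I b')%N.

Definition mandatory I (b : 'I_(nblocks I)) : nat :=
  (\sum_(i < K) floor_req I b i)%N.

Definition residual_budget I : nat :=
  (\sum_(b < nblocks I) (block_length I b - mandatory b))%N.

Definition block_of_round I (t : nat) : option 'I_(nblocks I) :=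
  [pick b | (block_start b <= t < block_start b + block_length I b)%N].

End Blocks.

(* Oldest observation first, so that [size h] is the current round. *)
Definition history (R : realType) (K : nat) := seq ('I_K * R).

Section Histories.
Context {R : realType} {K : nat}.
Implicit Types (I : fair_instance K) (h : history R K) (i : 'I_K).

Definition pulls h i : nat := count (fun p => p.1 == i) h.

Definition block_pulls I (b : 'I_(nblocks I)) h i : nat :=
  pulls (take (block_length I b) (drop (block_start b) h)) i.

Definition empirical_mean h i : R :=
  (\sum_(p <- h | p.1 == i) p.2) / (pulls h i)%:R.

End Histories.

(* Randomized, history-dependent policies.  Measurability in the observed
   rewards, for each fixed sequence of pulled arms, is what makes the
   integrals in [expectation] meaningful. *)
Record policy (R : realType) (K : nat) := Policy {
  pull_prob :> history R K -> 'I_K -> R ;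
  pull_prob_ge0 : forall h i, 0 <= pull_prob h i ;
  pull_prob_sum1 : forall h, \sum_(i < K) pull_prob h i = 1 ;
  pull_prob_measurable : forall n (a : n.-tuple 'I_K) i,
    measurable_fun [set: n.-tuple (measurableTypeR R)]
      (fun x : n.-tuple (measurableTypeR R) => pull_prob (zip a x) i) }.

(* [nu t i] is the law of the reward of arm [i] if it is pulled at round [t];
   rewards are independent but need not be identically distributed. *)
Definition reward_laws (R : realType) (K : nat) :=
  nat -> 'I_K -> probability (measurableTypeR R) R.

Section Model.
Context {R : realType} {K : nat}.
Implicit Types (I : fair_instance K) (pi : policy R K) (h : history R K).
Implicit Types (mu : 'I_K -> R) (nu : reward_laws R K).

Definition mean_vector mu : Prop := forall i, 0 <= mu i <= 1.

Definition has_means nu mu : Prop := forall t i,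
  nu t i `[0, 1]%classic = 1%E /\ (\int[nu t i]_x x%:E = (mu i)%:E)%E.

(* Conditional expectation of [F h'], where [h'] extends the history [h] by
   [n] rounds of play of [pi] against [nu]: the iterated integral against the
   transition kernels of the interaction. *)
Fixpoint expectation pi nu (n : nat) (F : history R K -> \bar R) h : \bar R :=
  if n is n'.+1 then
    (\sum_(i < K) (pi h i)%:E *
       \int[nu (size h) i]_x expectation pi nu n' F (rcons h (i, x)))%E
  else F h.

Definition total_mean mu h : R := \sum_(p <- h) mu p.1.

Definition mu_star mu : R := \big[Num.max/0]_(i < K) mu i.

Definition gap mu (i : 'I_K) : R := mu_star mu - mu i.

Definition best_arm mu : option 'I_K := [pick i | [forall j, mu j <= mu i]].

Definition opt I mu : R :=
  (horizon I)%:R * mu_star mu -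
  \sum_(b < nblocks I) \sum_(i < K | Some i != best_arm mu)
     (floor_req I b i)%:R * gap mu i.

Definition fair_regret I mu nu pi : \bar R :=
  ((opt I mu)%:E -
   expectation pi nu (horizon I) (fun h => (total_mean mu h)%:E) [::])%E.

Definition reachable pi h : Prop :=
  all (fun p => 0 <= p.2 <= 1) h /\
  (forall h1 i x h2, h = h1 ++ (i, x) :: h2 -> 0 < pi h1 i).

(* Fairness is pathwise: it is required on every full history whose arms [pi]
   can choose, whatever the rewards in [0, 1]. *)
Definition blockwise_fair I pi : Prop :=
  forall h, size h = horizon I -> reachable pi h ->
  forall (b : 'I_(nblocks I)) i, (floor_req I b i <= block_pulls b h i)%N.

End Model.

Section Minimax.
Context {R : realType}.

Definition reward_of_bool (b : bool) : measurableTypeR R := b%:R.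

Let measurable_reward_of_bool : measurable_fun setT reward_of_bool.
Proof. by []. Qed.

HB.instance Definition _ := @isMeasurableFun.Build _ _ bool (measurableTypeR R)
  reward_of_bool measurable_reward_of_bool.

Definition bernoulli_rewards {K : nat} (mu : 'I_K -> R) : reward_laws R K :=
  fun _ i => distribution (bernoulli_prob (mu i)) reward_of_bool.

(* The supremum over mean vectors is taken with Bernoulli rewards; lower bounds
   on it are a fortiori lower bounds on the supremum over all reward laws on
   [0, 1]. *)
Definition worst_fair_regret {K : nat} (I : fair_instance K)
    (pi : policy R K) : \bar R :=
  ereal_sup [set fair_regret I mu (bernoulli_rewards mu) pi
            | mu in mean_vector].

Definition minimax_fair_regret (K r : nat) : \bar R :=
  ereal_sup [set ereal_inf [set worst_fair_regret I pi
                           | pi in blockwise_fair I]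
            | I in [set I : fair_instance K | residual_budget I = r]].

End Minimax.

Section BDQ.
Context {R : realType} {K : nat} (I : fair_instance K) (eta : R).

Definition bdq_log : R := ln ((2 * K * horizon I)%:R / eta).

Definition ucb_index (h : history R K) (i : 'I_K) : \bar R :=
  if pulls h i == 0%N then +oo%E
  else (empirical_mean h i + Num.sqrt (2 * bdq_log / (pulls h i)%:R))%:E.

Definition bdq_arm (h : history R K) (i : 'I_K) : bool :=
  if block_of_round I (size h) is Some b then
    if (size h - block_start b < mandatory b)%N
    then (block_pulls b h i < floor_req I b i)%N
    else [forall j, (ucb_index h j <= ucb_index h i)%E]
  else true.

(* The order of the mandatory pulls and the tie-breaking among maximal indices
   are left to the policy. *)
Definition bdq_ucb (pi : policy R K) : Prop :=
  forall h i, (size h < horizon I)%N -> 0 < pi h i -> bdq_arm h i.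

Lemma bdq_arm_exists (h : history R K) : (0 < K)%N -> exists i, bdq_arm h i.
Proof.
move=> K0; rewrite /bdq_arm.
case: (block_of_round I (size h)) => [b|]; last by exists (Ordinal K0).
case: ltnP => [lt_m|_]; last first.
  have [i _ maxi] := @Order.TotalTheory.arg_maxP _ _ _ (Ordinal K0) xpredT
    (ucb_index h) isT.
  by exists i; apply/forallP => j; exact: maxi.
apply/existsP; apply: contraTT lt_m => /existsPn nolt; rewrite -leqNgt.
set h' := take (block_length I b) (drop (block_start b) h).
apply: (@leq_trans (size h')); last by rewrite size_take_min size_drop geq_minr.
have -> : size h' = (\sum_(i < K) pulls h' i)%N.
  elim: h' => [|p s IHs] /=; first by rewrite big1.
  rewrite /pulls /= big_split /= -IHs -big_mkcond /=.
  by rewrite (eq_bigl (pred1 p.1)) ?big_pred1_eq //= => i; rewrite eq_sym.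
by apply: leq_sum => i _; rewrite leqNgt; exact: nolt.
Qed.

Let measurable_of_bools d (T : measurableType d) (J : finType) d'
    (T' : measurableType d') (B : J -> T -> bool) (phi : {ffun J -> bool} -> T') :
  (forall j, measurable [set x | B j x]) ->
  measurable_fun [set: T] (fun x => phi [ffun j => B j x]).
Proof.
move=> mB _ Y mY; rewrite setTI.
have -> : (fun x => phi [ffun j => B j x]) @^-1` Y =
    \bigcup_(b in [set b | Y (phi b)])
      \bigcap_(j in [set: J]) [set x | B j x = b j].
  apply/seteqP; split => [x /= Yx|x [b /= Yb bx]].
    by exists [ffun j => B j x] => //= j _ /=; rewrite ffunE.
  rewrite /preimage /=; suff -> : [ffun j => B j x] = b by [].
  by apply/ffunP => j; rewrite ffunE; exact: bx.
apply: fin_bigcup_measurable => // b _.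
apply: fin_bigcap_measurable => // j _.
case: (b j); first exact: mB.
have -> : [set x | B j x = false] = ~` [set x | B j x].
  by apply/seteqP; split => x /=; case: (B j x).
exact/measurableC/mB.
Qed.

Let pulls_unzip1 (h : history R K) i : pulls h i = count (pred1 i) (unzip1 h).
Proof. by rewrite /pulls count_map. Qed.

Let unzip1_zip_tuple n (a : n.-tuple 'I_K) (x : n.-tuple R) :
  unzip1 (zip a x) = a.
Proof. by rewrite unzip1_zip // !size_tuple. Qed.

Let measurable_ucb n (a : n.-tuple 'I_K) i :
  measurable_fun [set: n.-tuple (measurableTypeR R)]
    (fun x : n.-tuple (measurableTypeR R) => ucb_index (zip a x) i).
Proof.
rewrite /ucb_index.
under eq_fun do rewrite /empirical_mean pulls_unzip1 unzip1_zip_tuple.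
case: eqP => _; first exact: measurable_cst.
apply/measurable_EFinP; apply: measurable_funD; last exact: measurable_cst.
apply: measurable_funM; last exact: measurable_cst.
rewrite (_ : (fun _ => _) = (fun x : n.-tuple (measurableTypeR R) =>
    \sum_(k <- enum 'I_n | tnth a k == i) (tnth x k : R))); last first.
  apply/funext => x; rewrite big_enum_cond /=.
  case: n a x => [|n] a x.
    by rewrite (tuple0 a) (tuple0 x) /= big_nil big_ord0.
  rewrite (big_nth (tnth a ord0, tnth x ord0)) size_zip !size_tuple minnn.
  rewrite big_mkord; apply: eq_big => k; rewrite nth_zip ?size_tuple //=.
    by rewrite -tnth_nth.
  by move=> _; rewrite -tnth_nth.
under eq_fun do rewrite big_mkcond.
apply: measurable_sum => k /=; case: (tnth a k == i); last exact: measurable_cst.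
exact: measurable_tnth.
Qed.

Let measurable_bdq_arm n (a : n.-tuple 'I_K) i :
  measurable [set x : n.-tuple (measurableTypeR R) | bdq_arm (zip a x) i].
Proof.
rewrite /bdq_arm.
have szE (x : n.-tuple R) : size (zip a x) = n.
  by rewrite size_zip !size_tuple minnn.
under eq_set do rewrite szE.
have mcst (c : bool) : measurable [set x : n.-tuple (measurableTypeR R) | c].
  case: c; [rewrite (_ : mkset _ = setT)|rewrite (_ : mkset _ = set0)] => //.
  - by apply/seteqP; split.
  - by apply/seteqP; split.
case: (block_of_round I n) => [b|]; last exact: mcst.
case: (n - block_start b < mandatory b)%N.
  under eq_set do rewrite /block_pulls pulls_unzip1 /unzip1 map_take map_drop
    -/unzip1 -/(unzip1 _) unzip1_zip_tuple.
  exact: mcst.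
have -> : [set x : n.-tuple (measurableTypeR R) |
      [forall j, ucb_index (zip a x) j <= ucb_index (zip a x) i]%E] =
    \bigcap_(j in [set: 'I_K]) [set x : n.-tuple (measurableTypeR R) |
      (ucb_index (zip a x) j <= ucb_index (zip a x) i)%E].
  apply/seteqP; split => [x /= /forallP H j _ //|x /= H]; first exact: H.
  by apply/forallP => j; exact: H.
apply: fin_bigcap_measurable => // j _.
rewrite -[X in measurable X]setTI; apply: measurable_lee => //.
- exact: measurable_ucb.
- exact: measurable_ucb.
Qed.

(* Nonvacuity of [bdq_ucb]. *)
Lemma bdq_ucb_exists : (0 < K)%N -> exists pi : policy R K, bdq_ucb pi.
Proof.
move=> K0.
pose phi (b : {ffun 'I_K -> bool}) : 'I_K := odflt (Ordinal K0) [pick j | b j].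
pose choice (h : history R K) : 'I_K := phi [ffun j => bdq_arm h j].
pose p h i : R := (choice h == i)%:R.
have p_ge0 h i : 0 <= p h i by rewrite /p ler0n.
have p_sum1 h : \sum_(i < K) p h i = 1.
  rewrite (bigD1 (choice h)) //= {1}/p eqxx big1 ?addr0 // => i /negPf.
  by rewrite eq_sym /p => ->.
have p_meas n (a : n.-tuple 'I_K) i :
    measurable_fun [set: n.-tuple (measurableTypeR R)]
      (fun x : n.-tuple (measurableTypeR R) => p (zip a x) i).
  apply: (@measurable_of_bools _ _ _ _ (measurableTypeR R)
    (fun j (x : n.-tuple (measurableTypeR R)) => bdq_arm (zip a x) j)
    (fun b => (phi b == i)%:R)) => j.
  exact: measurable_bdq_arm.
exists (Policy p_ge0 p_sum1 p_meas) => h i _ /=.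
rewrite /p /choice /phi; case: eqP => [<- _|]; last by rewrite ltxx.
case: pickP => [j|no]; first by rewrite ffunE.
have [j hj] := bdq_arm_exists h K0.
by have := no j; rewrite ffunE hj.
Qed.

End BDQ.

(* Main.v *)
(* Lower bound: on a single block of length r without floors, compare fair coins
   with the K instances in which one arm has bias e of order sqrt (K / r). The
   relative entropy between the two laws of the history is at most 4 e^2 times
   the mean number of pulls of the biased arm under fair coins, so on average
   over the arms the biased one is pulled at most a constant fraction < 1 of the
   time, whence a regret of order e r. Only rewards 0 and 1 matter, and all
   expectations become finite sums over a tree.

   Upper bound: beyond the mandatory pulls, which the benchmark also pays for, a
   residual pull of arm i costs at most twice its confidence width, unless some
   confidence interval fails; the widths add up to O(sqrt (L K R)). Failures are
   controlled pathwise by a sum G of exponential weights. Replacing e^(l x) by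
   the chord 1 - x + x e^l makes G affine in every reward, so that its
   conditional means are explicit under any reward laws with the given means, and
   the regret bound follows by backward induction using only monotonicity of the
   integral. *)
Require Import Defs.
From HB Require Import structures.
From mathcomp Require Import all_boot all_order all_algebra.
From mathcomp Require Import all_classical all_reals all_analysis.
From mathcomp Require Import measurable_realfun ring lra zify.
Import Order.TTheory GRing.Theory Num.Theory.
(* So that [expectation] is the one of Defs, not that of a random variable. *)
Import Defs.
Local Open Scope ring_scope.

(** * Integral bounds without measurability of the integrand *)

Section Integrals.
Local Open Scope ereal_scope.

(** Stated so as to apply to the iterated integrals in [expectation]: the integral of a nonnegative
    function is a supremum over the simple functions below it. *)
Lemma ge0_le_integral_nonmeas d (T : measurableType d) (R : realType)
    (m : {measure set T -> \bar R}) (f g : T -> \bar R) :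
  (forall x, 0 <= f x) -> (forall x, f x <= g x) ->
  \int[m]_x f x <= \int[m]_x g x.
Proof.
move=> f0 fg; have g0 x : 0 <= g x by rewrite (le_trans (f0 x)).
rewrite !ge0_integralTE//; apply: le_ereal_sup => _ [h hf <-]; exists h => //.
by move=> x; rewrite (le_trans (hf x)).
Qed.

(** Since [f] is controlled only on [[0, 1]], it is compared with the positive part of the affine
    function, set to 0 outside [[0, 1]]; this lies below [f] everywhere. *)
Lemma integral_ge_affine (R : realType)
    (P : probability (measurableTypeR R) R) (m : R)
    (f : measurableTypeR R -> \bar R) (a b : R) :
  P `[0%R, 1%R]%classic = 1 -> \int[P]_x x%:E = m%:E ->
  (forall x, 0 <= f x) ->
  (forall x : R, (0 <= x <= 1)%R -> (a + b * x)%:E <= f x) ->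
  (a + b * m)%:E <= \int[P]_x f x.
Proof.
move=> P01 Pm f0 fab; set D : set (measurableTypeR R) := `[0%R, 1%R]%classic.
have mD : measurable D by exact: measurable_itv.
have midE : measurable_fun [set: measurableTypeR R] (fun x : R => x).
  exact: measurable_id.
have iid : P.-integrable [set: measurableTypeR R] (EFin \o (fun x : R => x)).
  apply/integrableP; split; first exact/measurable_EFinP.
  by rewrite (@integral_fin_num_abs _ _ _ P setT (fun x : R => x))// Pm.
have ibid : P.-integrable [set: measurableTypeR R] (fun x : R => b%:E * x%:E).
  exact: integrableZl.
have ia : P.-integrable [set: measurableTypeR R] (cst a%:E).
  by apply: finite_measure_integrable_cst.
have iaff : P.-integrable [set: measurableTypeR R] (fun x : R => (a + b * x)%:E).
  have := integrableD measurableT ia ibid.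
  by apply: eq_integrable.
have <- : \int[P]_x (a + b * x)%:E = (a + b * m)%:E.
  under eq_integral do rewrite EFinD EFinM.
  rewrite integralD// integral_cst// integralZl// Pm.
  by rewrite [X in _ * X]probability_setT mule1.
rewrite (@negligible_integral _ _ _ P setT (~` D))//; last 2 first.
  exact: measurableC.
  by have := @probability_setC _ _ _ P D mD; rewrite P01 subee// => ->.

rewrite setDE setTI setCK.
apply: (@le_trans _ _ (\int[P]_(x in D) (fun x : R => (a + b * x)%:E)^\+ x)).
  rewrite integralE leeBlDr; last first.
    exact/integrable_neg_fin_num/(integrableS measurableT mD (@subsetT _ D) iaff).
  by rewrite leeDl// integral_ge0.
rewrite integral_mkcond; apply: ge0_le_integral_nonmeas => x.
  by rewrite patchE; case: ifP.
rewrite patchE; case: ifP => // /set_mem; rewrite /D/= in_itv/= => x01.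
by rewrite funeposE /= ge_max f0 andbT fab.
Qed.

Lemma integral_bernoulli_le (R : realType) K (p : 'I_K -> R) t i
    (f : R -> \bar R) : (0 <= p i <= 1)%R -> (forall x, 0 <= f x) ->
  \int[bernoulli_rewards p t i]_x f x <=
    (p i)%:E * f 1%R + (1 - p i)%:E * f 0%R.
Proof.
move=> p01 f0.
pose g (x : measurableTypeR R) : \bar R :=
  if x == 1%R then f 1%R else if x == 0%R then f 0%R else +oo.
apply: (@le_trans _ _ (\int[bernoulli_rewards p t i]_x g x)).
  apply: ge0_le_integral_nonmeas => // x; rewrite /g.
  by case: eqVneq => [->//|_]; case: eqVneq => [->//|_]; rewrite leey.
have m1 (a : measurableTypeR R) :
    measurable_fun setT (fun x : measurableTypeR R => x == a).
  by apply: (@measurable_fun_eqr _ _ _ setT id (cst a)).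
rewrite ge0_integral_distribution; last 2 first.
- apply: measurable_fun_ifT => //; apply: measurable_fun_ifT => //.
- move=> x; rewrite /g; case: ifP => // _; case: ifP => // _; exact: leey.
rewrite integral_bernoulli_prob//; last first.
  by move=> x /=; rewrite /g; case: ifP => // _; case: ifP => // _; rewrite leey.
by rewrite /g /= /reward_of_bool /= eqxx eq_sym oner_eq0 eqxx.
Qed.

End Integrals.

(** * Moment generating function of a Bernoulli variable *)

Section HoeffdingFactor.
Context {R : realType}.
Implicit Types x y l p : R.

Lemma sinh_le x : 0 <= x -> expR x - expR (- x) <= x * (expR x + expR (- x)).
Proof.
move=> x0; pose f (y : R) := y * (expR y + expR (- y)) - (expR y - expR (- y)).
have df (y : R) : is_derive y 1 f (y * (expR y - expR (- y))).
  rewrite /f; apply: is_derive_eq.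
  by rewrite /GRing.scale/=; ring.
suff : f 0 <= f x by rewrite /f mul0r oppr0 subrr subr0 subr_ge0.
apply: (@ger0_derive1_ndecr _ f 0 x) => // [y|].
- rewrite in_itv/= => /andP[y0 _]; rewrite derive1E; have [_ ->] := df y.
  by rewrite mulr_ge0 ?(ltW y0)// subr_ge0 ler_expR; lra.
- by apply: derivable_within_continuous => y _; have [] := df y.
Qed.

(** By evenness take [x >= 0]; there [e^(-y^2/2) (e^y + e^(-y))] is nonincreasing, the sign of its
    derivative being given by [sinh_le]. *)
Lemma cosh_le_expR x : (expR x + expR (- x)) / 2 <= expR (x ^+ 2 / 2).
Proof.
wlog x0 : x / 0 <= x => [wl|].
  have [/wl//|x0] := leP 0 x; have := wl (- x).
  by rewrite opprK sqrrN addrC; apply; rewrite oppr_ge0 ltW.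
pose f (y : R) := expR (- (y ^+ 2 / 2)) * (expR y + expR (- y)).
have df (y : R) : is_derive y 1 f
   (expR (- (y ^+ 2 / 2)) * ((expR y - expR (- y)) - y * (expR y + expR (- y)))).
  rewrite /f; apply: is_derive_eq.
  by rewrite /GRing.scale/=; field.
have : f x <= f 0.
  apply: (@ler0_derive1_nincr _ f 0 x) => // [z|].

  - rewrite in_itv/= => /andP[z0 _]; rewrite derive1E; have [_ ->] := df z.
    by rewrite mulr_ge0_le0 ?expR_ge0// subr_le0 sinh_le// ltW.
  - by apply: derivable_within_continuous => y _; have [] := df y.
rewrite /f expr0n/= mul0r !oppr0 expR0 mul1r expRN mulrC.
by rewrite ler_pdivrMr ?expR_gt0// => H; rewrite ler_pdivrMr// mulrC.
Qed.

Lemma expR_le_chord l x : 0 <= x <= 1 -> expR (l * x) <= 1 - x + x * expR l.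
Proof.
move=> /andP[x0 x1]; have := @convex_expR R (Itv01 x0 x1) l 0.
by rewrite !convRE /= expR0 /unstable.onem mulr0 addr0 mulr1 mulrC addrC.
Qed.

(* Symmetrization in closed form: multiplying by [p e^-l + 1 - p], which is at
   least [e^(-l p)], bounds the Bernoulli moment generating function by
   [1 + 2 p (1 - p) (cosh l - 1) <= (1 + cosh l) / 2]. *)
Lemma bernoulli_mgf_le l p : 0 <= p <= 1 ->
  1 - p + p * expR l <= expR (l * p + l ^+ 2 / 4).
Proof.
move=> p01; have /andP[p0 p1] := p01.
set u := 1 - p + p * expR l.
have u0 : 0 <= u by rewrite addr_ge0 ?mulr_ge0 ?expR_ge0 ?subr_ge0.
have chord := expR_le_chord (- l) p p01.
suff : u * expR (- l * p) <= expR (l ^+ 2 / 4).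
  by rewrite mulNr expRN ler_pdivrMr ?expR_gt0// -expRD addrC.
apply: (le_trans (ler_wpM2l u0 chord)).
have cosh_half : ((expR (l / 2) + expR (- (l / 2))) / 2) ^+ 2 <= expR (l ^+ 2 / 4).
  have -> : l ^+ 2 / 4 = 2%:R * ((l / 2) ^+ 2 / 2) by field.
  by rewrite expRM_natl; apply: lerXn2r; rewrite ?nnegrE ?expR_ge0 ?cosh_le_expR.
apply: (le_trans _ cosh_half).
have el : expR l = expR (l / 2) ^+ 2 by rewrite -expRM_natl; congr expR; field.
have eNl : expR (- l) = expR (- (l / 2)) ^+ 2.
  by rewrite -expRM_natl; congr expR; field.
have e1 : expR (l / 2) * expR (- (l / 2)) = 1 by rewrite expRxMexpNx_1.
rewrite /u el eNl; move: e1.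
set a := expR (l / 2); set b := expR (- (l / 2)) => e1.
have -> : (1 - p + p * a ^+ 2) * (1 - p + p * b ^+ 2) =
  (1 - p) ^+ 2 + p * (1 - p) * (a ^+ 2 + b ^+ 2) + p ^+ 2 * (a * b) ^+ 2 by ring.
rewrite e1 -subr_ge0.
have -> : ((a + b) / 2) ^+ 2 -
    ((1 - p) ^+ 2 + p * (1 - p) * (a ^+ 2 + b ^+ 2) + p ^+ 2 * 1 ^+ 2) =
    (1 / 4 - p * (1 - p)) * (a - b) ^+ 2 + (1 - 2 * p * (1 - p)) * (a * b - 1)
  by field.
rewrite e1 subrr mulr0 addr0 mulr_ge0 ?sqr_ge0//.
by have := sqr_ge0 (p - 1 / 2); rewrite expr2; nra.
Qed.

End HoeffdingFactor.

(** * Lower bound *)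

Section BernoulliTree.
Context {R : realType} {K : nat}.
Variable pi : policy R K.
Implicit Types (p : 'I_K -> R) (F G : history R K -> R) (h : history R K).

Definition bernoulli_step p F h : R :=
  \sum_(i < K) pi h i *
    (p i * F (rcons h (i, 1)) + (1 - p i) * F (rcons h (i, 0))).

Fixpoint bernoulli_expectation p (n : nat) F h : R :=
  if n is n'.+1 then bernoulli_step p (bernoulli_expectation p n' F) h
  else F h.

Lemma expectation_ge0 (nu : reward_laws R K) n (F : history R K -> \bar R) h :
  (forall h, 0 <= F h)%E -> (0 <= expectation pi nu n F h)%E.
Proof.
move=> F0; elim: n h => [|n IHn] h //=; apply: sume_ge0 => i _.
by rewrite mule_ge0 ?lee_fin ?pull_prob_ge0// integral_ge0.
Qed.

(** One inequality suffices: the expectation enters the regret with a minus sign, so bounding it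
    above bounds the regret below. *)
Lemma expectation_bernoulli_le p n F h :
  mean_vector p -> (forall h, 0 <= F h) ->
  (expectation pi (bernoulli_rewards p) n (fun h => (F h)%:E) h <=
     (bernoulli_expectation p n F h)%:E)%E.
Proof.
move=> p01 F0; elim: n h => [|n IHn] h //=.
rewrite /bernoulli_step -sumEFin; apply: lee_sum => i _.
rewrite EFinM lee_wpmul2l ?lee_fin ?pull_prob_ge0//.
apply: le_trans (integral_bernoulli_le _ _ _ (size h) _ _ (p01 i) _) _.
  by move=> x; apply: expectation_ge0 => h'; rewrite lee_fin.
have /andP[pi0 pi1] := p01 i.
by rewrite (EFinD (_ * _)) !EFinM leeD// lee_wpmul2l// lee_fin// subr_ge0.
Qed.

Lemma bernoulli_step_le p F G h : mean_vector p ->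
  (forall q, F (rcons h q) <= G (rcons h q)) ->
  bernoulli_step p F h <= bernoulli_step p G h.
Proof.
move=> p01 FG; apply: ler_sum => i _; have /andP[pi0 pi1] := p01 i.
by rewrite ler_wpM2l ?pull_prob_ge0// lerD// ler_wpM2l// subr_ge0.
Qed.

Lemma bernoulli_expectation_le p n F G h : mean_vector p ->
  (forall h', size h' = (size h + n)%N -> F h' <= G h') ->
  bernoulli_expectation p n F h <= bernoulli_expectation p n G h.
Proof.
move=> p01; elim: n h => [|n IHn] h FG /=; first by rewrite FG ?addn0.
apply: bernoulli_step_le => // q; apply: IHn => h' sz.
by rewrite FG// sz size_rcons addSnnS.
Qed.

Lemma eq_bernoulli_expectation p n F G h :
  (forall h', size h' = (size h + n)%N -> F h' = G h') ->
  bernoulli_expectation p n F h = bernoulli_expectation p n G h.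
Proof.
elim: n h => [|n IHn] h FG /=; first by rewrite FG ?addn0.
by apply: eq_bigr => i _; rewrite !IHn// => h' sz;
  rewrite FG// sz size_rcons addSnnS.
Qed.

Lemma bernoulli_expectation_supermartingale p n F h : mean_vector p ->
  (forall h, bernoulli_step p F h <= F h) ->
  bernoulli_expectation p n F h <= F h.
Proof.
move=> p01 HF; elim: n h => [|n IHn] h //=.
by apply: le_trans (HF h); apply: bernoulli_step_le.
Qed.

Lemma bernoulli_expectation_cst p n (c : R) h :
  bernoulli_expectation p n (fun=> c) h = c.
Proof.
elim: n h => [|n IHn] h //=; rewrite /bernoulli_step.
under eq_bigr do rewrite !IHn -mulrDl addrC subrK mul1r.
by rewrite -mulr_suml pull_prob_sum1 mul1r.
Qed.

Lemma bernoulli_expectationD p n F G h :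
  bernoulli_expectation p n (fun h => F h + G h) h =
  bernoulli_expectation p n F h + bernoulli_expectation p n G h.
Proof.
elim: n h => [|n IHn] h //=; rewrite /bernoulli_step -big_split /=.
by apply: eq_bigr => i _; rewrite !IHn; ring.
Qed.

Lemma bernoulli_expectationZ p n (c : R) F h :
  bernoulli_expectation p n (fun h => c * F h) h =
  c * bernoulli_expectation p n F h.
Proof.
elim: n h => [|n IHn] h //=; rewrite /bernoulli_step mulr_sumr.
by apply: eq_bigr => i _; rewrite !IHn; ring.
Qed.

Lemma bernoulli_expectation_sum p n (J : Type) (s : seq J)
    (F : J -> history R K -> R) h :
  bernoulli_expectation p n (fun h => \sum_(j <- s) F j h) h =
  \sum_(j <- s) bernoulli_expectation p n (F j) h.
Proof.
elim: n h => [|n IHn] h //=; rewrite /bernoulli_step exchange_big /=.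
apply: eq_bigr => i _; rewrite !IHn -mulr_sumr; congr (_ * _).
by rewrite big_split /= !mulr_sumr.
Qed.

End BernoulliTree.

(** * Pull counts along a history *)

Section Histories.
Context {R : realType} {K : nat}.
Implicit Types (mu : 'I_K -> R) (h : history R K) (i : 'I_K).

Lemma pulls_rcons h q i : pulls (rcons h q) i = (pulls h i + (q.1 == i))%N.
Proof. by rewrite /pulls -cats1 count_cat /= addn0. Qed.

Lemma pulls_cat h h' i : pulls (h ++ h') i = (pulls h i + pulls h' i)%N.
Proof. exact: count_cat. Qed.

Lemma pulls_le_size h i : (pulls h i <= size h)%N.
Proof. exact: count_size. Qed.

Lemma sum_pulls (V : nmodType) (g : 'I_K -> V) h :
  \sum_(q <- h) g q.1 = \sum_(i < K) g i *+ pulls h i.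
Proof.
elim: h => [|q h IHh]; first by rewrite big_nil big1.
rewrite big_cons IHh /pulls /=.
under [RHS]eq_bigr do rewrite mulrnDr.
rewrite big_split /=; congr (_ + _); rewrite (bigD1 q.1)//= eqxx big1 ?addr0//.
by move=> i /negPf; rewrite eq_sym => ->.
Qed.

Lemma sum_pulls_size h : (\sum_(i < K) pulls h i)%N = size h.
Proof.
elim: h => [|q h IHh]; first by rewrite big1.
rewrite /pulls /= big_split /= IHh -add1n; congr addn.
rewrite (bigD1 q.1)//= eqxx big1 ?addn0//.
by move=> i /negPf; rewrite eq_sym => ->.
Qed.

Lemma mu_starE mu i : 0 <= mu i -> (forall j, mu j <= mu i) ->
  mu_star mu = mu i.
Proof.
move=> mu0 mui; apply/le_anti/andP; split; last exact: le_bigmax.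
by apply: bigmax_le.
Qed.

End Histories.

(** * Fair against biased coins: change of measure and entropy *)

Section LowerBound.
Context {R : realType} {K : nat}.
Variables (pi : policy R K) (e : R).
Hypotheses (e_gt0 : 0 < e) (e_le : e <= 1 / 4).
Implicit Types (h : history R K) (i j : 'I_K).

Definition fair_coins : 'I_K -> R := fun=> 1 / 2.

Definition biased_coin i : 'I_K -> R :=
  fun j => if j == i then 1 / 2 + e else 1 / 2.

Lemma mean_vector_fair_coins : mean_vector fair_coins.
Proof. by move=> j; rewrite /fair_coins; lra. Qed.

Lemma mean_vector_biased_coin i : mean_vector (biased_coin i).
Proof.
by move=> j; rewrite /biased_coin; move: e_gt0 e_le; case: (j == i); lra.
Qed.

(* Density of the [biased_coin i] law with respect to [fair_coins]; any reward
   other than 1 counts as tails, so that it is positive on every history. *)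
Definition likelihood i h : R :=
  \prod_(q <- h) (if q.1 == i then if q.2 == 1 then 1 + 2 * e else 1 - 2 * e
                  else 1).

Lemma likelihood_gt0 i h : 0 < likelihood i h.
Proof.
apply: prodr_gt0 => q _; move: e_gt0 e_le.
by case: (q.1 == i) => //; case: (q.2 == 1); lra.
Qed.

Lemma likelihood_rcons i h q : likelihood i (rcons h q) = likelihood i h *
  (if q.1 == i then if q.2 == 1 then 1 + 2 * e else 1 - 2 * e else 1).
Proof. by rewrite /likelihood big_rcons. Qed.

(** Each factor [1 + 2 e] or [1 - 2 e] is the ratio of [1/2 + e] or [1/2 - e] to [1/2], so the
    identity propagates round by round. *)
Lemma change_of_measure i n (F : history R K -> R) h :
  likelihood i h * bernoulli_expectation pi (biased_coin i) n F h =
  bernoulli_expectation pi fair_coins n (fun h => likelihood i h * F h) h.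
Proof.
elim: n h => [|n IHn] h //=; rewrite /bernoulli_step mulr_sumr.
apply: eq_bigr => j _; rewrite -!IHn !likelihood_rcons /= eqxx.
rewrite [0 == 1]eq_sym oner_eq0 /biased_coin /fair_coins.
by case: (j == i); field.
Qed.

(** Under fair coins a pull of arm [i] raises [- ln (likelihood i h)] on average by
    [- ln (1 - 4 e^2) / 2 <= 4 e^2], and other pulls leave it fixed; so [D] below is a
    supermartingale that starts at 0. *)
Lemma relative_entropy_le i n :
  bernoulli_expectation pi fair_coins n (fun h => - ln (likelihood i h)) [::]
  <= 4 * e ^+ 2 *
     bernoulli_expectation pi fair_coins n (fun h => (pulls h i)%:R) [::].
Proof.
pose D h := - ln (likelihood i h) + - (4 * e ^+ 2) * (pulls h i)%:R.
have /(bernoulli_expectation_supermartingale pi fair_coins n D [::]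
    mean_vector_fair_coins) : forall h, bernoulli_step pi fair_coins D h <= D h.
  move=> h; rewrite /bernoulli_step.
  rewrite [leRHS](_ : _ = \sum_(j < K) pi h j * D h); last first.
    by rewrite -mulr_suml pull_prob_sum1 mul1r.
  apply: ler_sum => j _.
  rewrite ler_wpM2l ?pull_prob_ge0// /D /fair_coins !likelihood_rcons/=.
  rewrite !pulls_rcons/= eqxx [0 == 1]eq_sym oner_eq0.
  case: (j == i) => /=; last by rewrite !mulr1 !addn0; lra.
  have e1 : 0 < 1 + 2 * e by move: e_gt0; lra.
  have e2 : 0 < 1 - 2 * e by move: e_le; lra.
  rewrite !lnM ?posrE ?likelihood_gt0//.
  rewrite natrD.
  suff : - (8 * e ^+ 2) <= ln (1 + 2 * e) + ln (1 - 2 * e) by lra.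
  rewrite -lnM ?posrE//.
  have -> : (1 + 2 * e) * (1 - 2 * e) = 1 - 4 * e ^+ 2 by ring.
  set y := 4 * e ^+ 2; have y01 : 0 < y <= 1 / 4.
    rewrite /y mulr_gt0 ?exprn_gt0//=.
    by rewrite expr2; move: e_gt0 e_le; nra.
  have y1 : 0 < 1 - y by move: y01; lra.
  rewrite -[1 - y]invrK lnV ?posrE ?invr_gt0// lerN2.
  have -> : (1 - y)^-1 = 1 + y / (1 - y) by field; move: y01; lra.
  apply: le_trans (le_ln1Dx _) _.
    by apply: (@lt_le_trans _ _ 0); rewrite ?ltrN10// divr_ge0//; move: y01; lra.
  rewrite ler_pdivrMr// (_ : 8 * e ^+ 2 = 2 * y); last by rewrite /y; ring.
  by move: y01; nra.
rewrite bernoulli_expectationD bernoulli_expectationZ /D /likelihood big_nil ln1.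
by rewrite oppr0 add0r mulr0; lra.
Qed.

(* [ln x <= 2 (sqrt x - 1)] bounds [x - 1 - ln x] below by the squared Hellinger
   term [(1 - sqrt x) ^ 2]. *)
Lemma tv_le_entropy (x d : R) : 0 < x -> 0 < d ->
  Num.max 0 (1 - x) <= d + (x - 1 - ln x) / d.
Proof.
move=> x0 d0; set s := Num.sqrt x.
have s0 : 0 < s by rewrite sqrtr_gt0.
have xE : x = s ^+ 2 by rewrite sqr_sqrtr// ltW.
have lns : ln x <= 2 * (s - 1).
  have : ln s <= s - 1.
    by rewrite -[s in ln s](addrNK 1) addrC le_ln1Dx// ltrBrDr addNr.
  by rewrite xE lnXn// mulr2n; lra.
have ent : (1 - s) ^+ 2 <= x - 1 - ln x.
  by rewrite xE in lns *; move: lns; rewrite !expr2; lra.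
have amgm : 2 * (1 - s) <= d + (x - 1 - ln x) / d.
  apply: (@le_trans _ _ (d + (1 - s) ^+ 2 / d)).
    rewrite -subr_ge0.
    have -> : d + (1 - s) ^+ 2 / d - 2 * (1 - s) = (d - (1 - s)) ^+ 2 / d.
      by field; rewrite gt_eqF.
    by rewrite divr_ge0 ?sqr_ge0// ltW.
  by rewrite lerD2l ler_wpM2r// invr_ge0 ltW.
rewrite ge_max; apply/andP; split.
  by rewrite addr_ge0 ?divr_ge0 ?(ltW d0)// (le_trans _ ent)// sqr_ge0.
by apply: le_trans amgm; have := sqr_ge0 (1 - s); rewrite xE !expr2; lra.
Qed.

(** With [x] the likelihood and [N] the pulls, [E x = 1] turns [E[(x - 1) N]] into
    [E[(1 - x) (n - N)] <= n E[max(0, 1 - x)]], which [tv_le_entropy] bounds. The free [d] stands in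
    for the square root of Pinsker's inequality. *)
Lemma pulls_biased_coin_le i n (d : R) : 0 < d ->
  bernoulli_expectation pi (biased_coin i) n (fun h => (pulls h i)%:R) [::] <=
  (1 + 4 * e ^+ 2 * n%:R / d) *
    bernoulli_expectation pi fair_coins n (fun h => (pulls h i)%:R) [::] +
  n%:R * d.
Proof.
move=> d0; set N0 := bernoulli_expectation _ fair_coins _ _ _.
have l1 : likelihood i [::] = 1 by rewrite /likelihood big_nil.
have E1 : bernoulli_expectation pi fair_coins n (likelihood i) [::] = 1.
  have := change_of_measure i n (fun=> 1) [::].
  rewrite bernoulli_expectation_cst l1 mulr1 => ->; congr bernoulli_expectation.
  by apply/funext => h; rewrite mulr1.
have := change_of_measure i n (fun h => (pulls h i)%:R) [::].
rewrite l1 mul1r => ->.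
set c := n%:R / d.
apply: (@le_trans _ _ (bernoulli_expectation pi fair_coins n (fun h =>
    (pulls h i)%:R + ((n%:R + c) * likelihood i h +
     ((n%:R * d - n%:R - c) + c * - ln (likelihood i h)))) [::])).
  apply: bernoulli_expectation_le; first exact: mean_vector_fair_coins.
  move=> h sz; have := tv_le_entropy (likelihood i h) d (likelihood_gt0 i h) d0.
  rewrite ge_max => /andP[tv1 tv2].
  have N0n : (pulls h i)%:R <= n%:R :> R by rewrite ler_nat -[n]add0n -sz pulls_le_size.
  have N0' : 0 <= (pulls h i)%:R :> R by [].
  have cE : c = n%:R * d^-1 by [].
  set x := likelihood i h in tv1 tv2 *.
  rewrite -subr_ge0.
  rewrite [leRHS](_ : _ =
     (n%:R - (pulls h i)%:R) * ((d + (x - 1 - ln x) / d) - (1 - x)) +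
     (pulls h i)%:R * (d + (x - 1 - ln x) / d)); last by rewrite cE; ring.
  by rewrite addr_ge0// mulr_ge0// subr_ge0.
rewrite !bernoulli_expectationD !bernoulli_expectationZ.
rewrite E1 mulr1 !bernoulli_expectation_cst -/N0.
have := relative_entropy_le i n; rewrite -/N0 => H.
have c0 : 0 <= c by rewrite divr_ge0// ltW.
have := ler_wpM2l c0 H.
have -> : c * (4 * e ^+ 2 * N0) = 4 * e ^+ 2 * n%:R / d * N0.
  by rewrite /c; ring.
lra.
Qed.

Lemma total_mean_biased_coin i h :
  total_mean (biased_coin i) h = (size h)%:R / 2 + e * (pulls h i)%:R.
Proof.
elim: h => [|q h IHh]; first by rewrite /total_mean big_nil !mul0r mulr0 addr0.
rewrite /total_mean big_cons -/(total_mean _ _) IHh /pulls /= natrD -/(pulls h i).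
by rewrite /biased_coin -natr1; case: (q.1 == i) => /=; lra.
Qed.

(** Averaging over the arms: under fair coins the pulls of all arms add up to [n], so the bounds of
    [pulls_biased_coin_le] average to the right-hand side. *)
Lemma exists_biased_coin n (d : R) : (0 < K)%N -> 0 < d ->
  exists i, bernoulli_expectation pi (biased_coin i) n
    (fun h => (pulls h i)%:R) [::] <=
  n%:R / K%:R + 4 * e ^+ 2 * n%:R ^+ 2 / (d * K%:R) + n%:R * d.
Proof.
move=> K0 d0; apply: contrapT => /forallNP H.
pose B := n%:R / K%:R + 4 * e ^+ 2 * n%:R ^+ 2 / (d * K%:R) + n%:R * d.
pose E i := bernoulli_expectation pi (biased_coin i) n (fun h => (pulls h i)%:R) [::].
pose E0 i := bernoulli_expectation pi fair_coins n (fun h => (pulls h i)%:R) [::].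
have KR : 0 < K%:R :> R by rewrite ltr0n.
have : \sum_(i < K) E i <= K%:R * B.
  apply: (@le_trans _ _ (\sum_(i < K) ((1 + 4 * e ^+ 2 * n%:R / d) * E0 i + n%:R * d))).
    by apply: ler_sum => i _; exact: pulls_biased_coin_le.
  rewrite big_split /= -mulr_sumr -bernoulli_expectation_sum sumr_const card_ord.
  have -> : bernoulli_expectation pi fair_coins n
      (fun h => \sum_(i < K) (pulls h i)%:R) [::] = n%:R.
    rewrite -[RHS](bernoulli_expectation_cst pi fair_coins n n%:R [::]).
    apply: eq_bernoulli_expectation => h sz.
    by rewrite -natr_sum sum_pulls_size sz.
  rewrite -mulr_natr /B le_eqVlt; apply/orP; left; apply/eqP; field.
  by rewrite !gt_eqF.
apply/negP; rewrite -ltNge.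
have -> : K%:R * B = \sum_(i < K) B by rewrite sumr_const card_ord mulr_natl.
apply: ltr_sum.
  by apply/hasP; exists (Ordinal K0); rewrite ?mem_index_enum.
by move=> i _; rewrite ltNge; apply/negP/H.
Qed.

End LowerBound.

(** * The hard instance and its regret *)

Definition single_block_instance (K r : nat) : fair_instance K.
Proof.
apply: (@FairInstance K 1 (fun=> r) (fun _ _ => 0%N)) => b.
by rewrite big1.
Defined.

Lemma residual_single_block K r :
  residual_budget (single_block_instance K r) = r.
Proof. by rewrite /residual_budget /mandatory big_ord1 big1 ?subn0. Qed.

Lemma minimax_lower_bound (R : realType) (K r : nat) (pi : policy R K) :
  (2 <= K)%N -> (K <= r)%N ->
  ((5 / 384 * Num.sqrt (K * r)%:R)%:E <=
     worst_fair_regret (single_block_instance K r) pi)%E.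
Proof.
move=> K2 Kr; set I := single_block_instance K r.
have K0 : (0 < K)%N by apply: leq_trans K2.
have r0 : (0 < r)%N by apply: leq_trans Kr.
have K0R : 0 < K%:R :> R by rewrite ltr0n.
have r0R : 0 < r%:R :> R by rewrite ltr0n.
have KrR : K%:R <= r%:R :> R by rewrite ler_nat.
set s := Num.sqrt (K * r)%:R.
have s2 : s ^+ 2 = K%:R * r%:R by rewrite sqr_sqrtr ?ler0n// natrM.
have s0 : 0 < s by rewrite sqrtr_gt0 ltr0n muln_gt0 K0.
have sr : s <= r%:R.
  by rewrite -(@ler_pXn2r _ 2) ?nnegrE ?ler0n ?sqrtr_ge0// s2 expr2 ler_wpM2r.
(* The bias of order [sqrt (K / r)], chosen so that the average over the arms
   of the pulls of the biased one stays below [11 r / 16]. *)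
pose e : R := s / r%:R / 24.
have e0 : 0 < e by rewrite !divr_gt0.
have e1 : e <= 1 / 4.
  have : s / r%:R <= 1 by rewrite ler_pdivrMr ?mul1r.
  by rewrite /e; lra.
have er : e * r%:R = s / 24 by rewrite /e; field; rewrite gt_eqF.
have d0 : 0 < 1 / 8 :> R by lra.
have [i Ei] := exists_biased_coin pi e e0 e1 r (1 / 8) K0 d0.
have HT : horizon I = r by rewrite /horizon big_ord1.
have muE : mu_star (biased_coin e i) = 1 / 2 + e.
  rewrite (@mu_starE _ _ _ i) /biased_coin ?eqxx//; first by move: e0; lra.
  by move=> j; case: (j == i) => //; move: e0; lra.
have optE : opt I (biased_coin e i) = r%:R * (1 / 2 + e).
  rewrite /opt muE HT big_ord1 big1 ?subr0// => j _.
  by rewrite mul0r.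
apply: (@le_trans _ _ (fair_regret I (biased_coin e i)
    (bernoulli_rewards (biased_coin e i)) pi)); last first.
  apply: ereal_sup_ubound; exists (biased_coin e i) => //.
  exact: mean_vector_biased_coin.
set E := bernoulli_expectation _ _ _ _ _ in Ei.
(* [11/16] exceeds [1/2 + 1/18 + 1/8]: the share [1/K <= 1/2], the entropy term, and [d = 1/8]. The
   remaining [5/16] of the rounds lose [e] each. *)
have Er : E <= 11 / 16 * r%:R.
  apply: le_trans Ei _.
  have -> : 4 * e ^+ 2 * r%:R ^+ 2 / (1 / 8 * K%:R) = r%:R / 18.
    have -> : 4 * e ^+ 2 * r%:R ^+ 2 / (1 / 8 * K%:R) =
        32 * (e * r%:R) ^+ 2 / K%:R by field; rewrite gt_eqF.
    by rewrite er exprMn s2; field; rewrite gt_eqF.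
  have : r%:R / K%:R <= r%:R / 2 :> R.
    by rewrite ler_pM2l// lef_pV2 ?posrE// ler_nat.
  by move: r0R; lra.
have tmE : bernoulli_expectation pi (biased_coin e i) r
    (total_mean (biased_coin e i)) [::] = r%:R / 2 + e * E.
  rewrite /E -bernoulli_expectationZ.
  rewrite -[X in _ = X + _](bernoulli_expectation_cst pi (biased_coin e i) r _ [::]).
  rewrite -bernoulli_expectationD; apply: eq_bernoulli_expectation => h sz.
  by rewrite total_mean_biased_coin sz.
rewrite /fair_regret optE HT.
apply: le_trans (leeB (lexx _) (expectation_bernoulli_le pi _ r
  (total_mean (biased_coin e i)) [::] _ _)); last 2 first.
- exact: mean_vector_biased_coin.
- move=> h; apply: sumr_ge0 => q _.
  by have /andP[] := mean_vector_biased_coin e e0 e1 i q.1.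
rewrite -EFinB lee_fin tmE.
have -> : 5 / 384 * s = 5 / 16 * (e * r%:R) by rewrite er; field.
by have := ler_wpM2l (ltW e0) Er; lra.
Qed.

(** * Upper bound *)

Section RewardMartingales.
Context {R : realType} {K : nat}.
Variables (mu : 'I_K -> R).
Implicit Types (h : history R K) (i j : 'I_K) (G : history R K -> R) (l : R).

(* A martingale for every reward law of mean vector [mu] and every policy,
   because its increments are linear in the centred reward. *)
Definition linear_martingale G : Prop := forall h j, exists b,
  forall x, G (rcons h (j, x)) = G h + b * (x - mu j).

Lemma linear_martingale_sum (J : Type) (s : seq J) (P : pred J)
    (G : J -> history R K -> R) : (forall k, linear_martingale (G k)) ->
  linear_martingale (fun h => \sum_(k <- s | P k) G k h).
Proof.
move=> mG h j; elim: s => [|k s [b Hb]].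
  by exists 0 => x; rewrite !big_nil mul0r addr0.
have [b' Hb'] := mG k h j; exists (if P k then b' + b else b) => x.
by rewrite !big_cons Hb Hb'; case: (P k) => //; ring.
Qed.

Lemma linear_martingaleD G G' : linear_martingale G -> linear_martingale G' ->
  linear_martingale (fun h => G h + G' h).
Proof.
move=> mG mG' h j; have [b Hb] := mG h j; have [b' Hb'] := mG' h j.
by exists (b + b') => x; rewrite Hb Hb'; ring.
Qed.

Lemma linear_martingaleZ (c : R) G : linear_martingale G ->
  linear_martingale (fun h => c * G h).
Proof.
by move=> mG h j; have [b Hb] := mG h j; exists (c * b) => x; rewrite Hb; ring.
Qed.

(** Freezing at round [t] lets the failure weights of different rounds be added as functions of the
    full history. *)
Lemma linear_martingale_take t G : linear_martingale G ->
  linear_martingale (fun h => G (take t h)).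
Proof.
move=> mG h j; have [th|ht] := leqP t (size h).
  exists 0 => x; rewrite mul0r addr0 -cats1 takel_cat//.
have [b Hb] := mG h j; exists b => x.
by rewrite !take_oversize ?size_rcons// ltnW.
Qed.

Lemma reachable_rcons (pi : policy R K) h i x :
  reachable pi h -> 0 < pi h i -> 0 <= x <= 1 -> reachable pi (rcons h (i, x)).
Proof.
move=> [h01 hpi] pi0 x01; split; first by rewrite all_rcons /= x01.
move=> h1 j y h2; case/lastP: h2 => [|h2 q].
  by rewrite cats1 => /rcons_inj[<- <- _].
by rewrite -rcons_cons -rcons_cat => /rcons_inj[/hpi].
Qed.

(** [c - G] is affine in the next reward, so [integral_ge_affine] carries the bound back one round.
    Arms of probability 0 contribute nothing, hence the final bound is asked only on reachable
    histories. *)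
Lemma expectation_ge_martingale (nu : reward_laws R K) (pi : policy R K)
    (F G : history R K -> R) (c : R) n h :
  has_means nu mu -> linear_martingale G -> (forall h, 0 <= F h) ->
  (forall h', size h' = (size h + n)%N -> reachable pi h' ->
     c - G h' <= F h') ->
  reachable pi h ->
  ((c - G h)%:E <= expectation pi nu n (fun h => (F h)%:E) h)%E.
Proof.
move=> nu_mu mG F0; elim: n h => [|n IHn] h FG hr /=.
  by rewrite lee_fin FG// addn0.
rewrite -[c - G h]mul1r -(pull_prob_sum1 pi h) mulr_suml -sumEFin.
apply: lee_sum => i _; rewrite EFinM.
have := pull_prob_ge0 pi h i; rewrite le_eqVlt => /predU1P[<-|pi0].
  by rewrite !mul0e.
apply: lee_wpmul2l; first by rewrite lee_fin ltW.
have [b Gb] := mG h i.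
have -> : c - G h = (c - G h + b * mu i) + (- b) * mu i by ring.
have [nu01 numu] := nu_mu (size h) i.
apply: integral_ge_affine => // x => [|x01].
  by apply: expectation_ge0 => h'; rewrite lee_fin.
have -> : c - G h + b * mu i + - b * x = c - G (rcons h (i, x)).
  by rewrite Gb; ring.
apply: IHn; last exact: reachable_rcons.
by move=> h' sz; apply: FG; rewrite sz size_rcons addSnnS.
Qed.

Definition mgf_factor l i (x : R) : R :=
  (1 - x + x * expR l) / (1 - mu i + mu i * expR l).

(* Dominates the exponential supermartingale of the Hoeffding bound, see
   [reward_weight_ge]. *)
Definition reward_weight l i h : R :=
  \prod_(q <- h | q.1 == i) mgf_factor l i q.2.

Hypothesis mu01 : mean_vector mu.

Lemma chord_gt0 l (x : R) : 0 <= x <= 1 -> 0 < 1 - x + x * expR l.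
Proof.
by move=> x01; apply: lt_le_trans (expR_le_chord l x x01); exact: expR_gt0.
Qed.

Lemma mgf_factor_gt0 l i x : 0 <= x <= 1 -> 0 < mgf_factor l i x.
Proof. by move=> x01; rewrite divr_gt0// chord_gt0. Qed.

Lemma reward_weight_rcons l i h q : reward_weight l i (rcons h q) =
  reward_weight l i h * (if q.1 == i then mgf_factor l i q.2 else 1).
Proof.
rewrite /reward_weight -cats1 big_cat /= big_cons big_nil.
by case: ifP; rewrite ?mulr1.
Qed.

(** [mgf_factor l i] is affine in the reward and equals 1 at [mu i], so each increment is a multiple
    of [x - mu i]. *)
Lemma reward_weight_martingale l i : linear_martingale (reward_weight l i).
Proof.
move=> h j; have [->|ji] := eqVneq j i; last first.
  exists 0 => x; rewrite reward_weight_rcons /= (negPf ji); ring.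
exists (reward_weight l i h * (expR l - 1) / (1 - mu i + mu i * expR l)) => x.
rewrite reward_weight_rcons /= eqxx /mgf_factor; field.
by rewrite gt_eqF// chord_gt0.
Qed.

Lemma reward_weight_ge0 l i h : all (fun q => 0 <= q.2 <= 1) h ->
  0 <= reward_weight l i h.
Proof.
move=> /allP h01; rewrite /reward_weight big_seq_cond; apply: prodr_ge0 => q.
by case/andP => /h01 q01 _; rewrite ltW// mgf_factor_gt0.
Qed.

Lemma reward_weight_ge l i h : all (fun q => 0 <= q.2 <= 1) h ->
  expR (l * (\sum_(q <- h | q.1 == i) q.2 - mu i * (pulls h i)%:R)
        - l ^+ 2 / 4 * (pulls h i)%:R) <= reward_weight l i h.
Proof.
elim: h => [|q h IHh] /=.
  by rewrite /reward_weight /pulls !big_nil /= !(mulr0, subr0) expR0.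
case/andP => q01 /[dup] h01 /IHh.
rewrite /reward_weight !big_cons /pulls /=; case: (q.1 == i); last first.
  by rewrite add0n.
rewrite -/(pulls h i) natrD => IH.
have -> : l * (q.2 + \sum_(p <- h | p.1 == i) p.2 -
    mu i * (1 + (pulls h i)%:R)) - l ^+ 2 / 4 * (1 + (pulls h i)%:R) =
    (l * q.2 - (l * mu i + l ^+ 2 / 4)) +
    (l * (\sum_(p <- h | p.1 == i) p.2 - mu i * (pulls h i)%:R)
     - l ^+ 2 / 4 * (pulls h i)%:R) by ring.
rewrite expRD; apply: ler_pM => //; try exact: expR_ge0.
rewrite expRB; apply: ler_pM; rewrite ?invr_ge0 ?expR_ge0//.
  exact: expR_le_chord.
by rewrite lef_pV2 ?posrE ?expR_gt0 ?chord_gt0// bernoulli_mgf_le.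
Qed.

End RewardMartingales.

(** * Splitting the horizon into blocks and phases *)

Section Blocks.
Context {K : nat}.
Variable I : fair_instance K.
Implicit Types (b : 'I_(nblocks I)) (k t : nat).

(** Lengths and starts are extended to all natural indices, with length 0 past the last block, so
    that sums over blocks yield to induction. *)
Let len k : nat := oapp (block_length I) 0%N (insub k).
Let start k : nat := (\sum_(0 <= j < k) len j)%N.

Let lenE b : len b = block_length I b.
Proof. by rewrite /len valK. Qed.

Let startE b : block_start b = start b.
Proof.
have bn : (b <= nblocks I)%N by rewrite ltnW.
rewrite /start [RHS](@big_nat_widen _ _ _ 0 b (nblocks I) _ _ bn) big_mkord.
by apply: eq_bigr => b' _; rewrite lenE.
Qed.

Let horizonE : horizon I = start (nblocks I).
Proof. by rewrite /horizon /start big_mkord; apply: eq_bigr => b _; rewrite lenE. Qed.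

Let startS k : start k.+1 = (start k + len k)%N.
Proof. by rewrite /start big_nat_recr. Qed.

Let start_le k k' : (k <= k')%N -> (start k <= start k')%N.
Proof. by move=> kk'; rewrite /start (@big_cat_nat _ _ _ k 0 k')//= leq_addr. Qed.

Lemma block_end_le_horizon b :
  (block_start b + block_length I b <= horizon I)%N.
Proof. by rewrite startE -lenE -startS horizonE start_le. Qed.

Lemma block_of_round_start b k : (k < block_length I b)%N ->
  block_of_round I (block_start b + k) = Some b.
Proof.
move=> kb; rewrite /block_of_round; case: pickP => [b'|/(_ b)]; last first.
  by rewrite leq_addr ltn_add2l kb.
rewrite !startE -lenE => /andP[b1 b2]; rewrite -lenE in kb.
congr Some; apply/val_inj; case: (ltngtP b' b) => // /start_le;
  rewrite startS; lia.
Qed.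

Lemma sum_blocks (V : nmodType) (F : nat -> V) :
  \sum_(0 <= t < horizon I) F t =
  \sum_(b < nblocks I) \sum_(0 <= k < block_length I b) F (block_start b + k)%N.
Proof.
under [RHS]eq_bigr do rewrite startE -lenE.
rewrite horizonE -(big_mkord xpredT
  (fun j => \sum_(0 <= k < len j) F (start j + k)%N)).
elim: (nblocks I) => [|n IHn]; first by rewrite /start !big_geq.
rewrite startS big_nat_recr//= -IHn (@big_cat_nat _ _ _ (start n))//= ?leq_addr//.
congr (_ + _); rewrite -{1}[start n]add0n big_addn addKn.
by apply: eq_bigr => k _; rewrite addnC.
Qed.

Definition residual_round t : bool :=
  if block_of_round I t is Some b then (mandatory b <= t - block_start b)%N
  else false.

Lemma mandatory_le b : (mandatory b <= block_length I b)%N.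
Proof. exact: floor_req_le. Qed.

Lemma sum_mandatory_rounds (V : nmodType) (F : nat -> V) :
  \sum_(0 <= t < horizon I | ~~ residual_round t) F t =
  \sum_(b < nblocks I) \sum_(0 <= k < mandatory b) F (block_start b + k)%N.
Proof.
rewrite big_mkcond sum_blocks; apply: eq_bigr => b _.
rewrite (@big_cat_nat _ _ _ (mandatory b))//= ?mandatory_le//.
rewrite [X in _ + X]big1_seq ?addr0 => [|k]; last first.
  rewrite /= mem_index_iota /residual_round => /andP[mk kb].
  by rewrite block_of_round_start// addKn mk.
apply: eq_big_seq => k; rewrite mem_index_iota /residual_round => /andP[_ km].
by rewrite block_of_round_start ?(leq_trans km)// ?mandatory_le// addKn leqNgt km.
Qed.

Lemma count_residual_rounds :
  (\sum_(0 <= t < horizon I | residual_round t) 1 = residual_budget I)%N.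
Proof.
rewrite big_mkcond sum_blocks; apply: eq_bigr => b _.
rewrite (@big_cat_nat _ _ _ (mandatory b))//= ?mandatory_le//.
rewrite [X in X + _]big1_seq => [|k]; last first.
  rewrite /= mem_index_iota /residual_round => /andP[_ km].
  by rewrite block_of_round_start ?(leq_trans km)// ?mandatory_le// addKn leqNgt km.
rewrite add0r -[RHS]muln1 -sum_nat_const_nat; apply: eq_big_seq => k.
rewrite mem_index_iota /residual_round => /andP[mk kb].
by rewrite block_of_round_start// addKn mk.
Qed.

Lemma residual_budget_le_horizon : (residual_budget I <= horizon I)%N.
Proof. by apply: leq_sum => b _; rewrite leq_subr. Qed.

End Blocks.

(** * Reachable paths of BDQ-UCB *)

Lemma reachable_pull_prob_gt0 (R : realType) K (pi : policy R K)
    (h : history R K) t q0 :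
  reachable pi h -> (t < size h)%N -> 0 < pi (take t h) (nth q0 h t).1.
Proof.
move=> [_ hpi] th; apply: (hpi _ _ (nth q0 h t).2 (drop t.+1 h)).
by rewrite -surjective_pairing -drop_nth// cat_take_drop.
Qed.

Section BDQPath.
Context {R : realType} {K : nat}.
Variables (I : fair_instance K) (eta : R) (pi : policy R K).
Hypothesis pi_bdq : bdq_ucb I eta pi.
Variables (h : history R K) (q0 : 'I_K * R).
Hypotheses (size_h : size h = horizon I) (reach_h : reachable pi h).

Let arm t := (nth q0 h t).1.

Lemma bdq_arm_nth t : (t < horizon I)%N -> bdq_arm I eta (take t h) (arm t).
Proof.
move=> tT; apply: pi_bdq; first by rewrite size_takel// size_h// ltnW.
by apply: reachable_pull_prob_gt0 => //; rewrite size_h.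
Qed.

Lemma residual_round_index_le t : (t < horizon I)%N -> residual_round I t ->
  forall j, (ucb_index I eta (take t h) j <= ucb_index I eta (take t h) (arm t))%E.
Proof.
move=> tT; have := bdq_arm_nth t tT; rewrite /bdq_arm /residual_round.
rewrite size_takel ?size_h 1?ltnW//; case: block_of_round => // b.
by move=> + mb; rewrite ltnNge mb => /forallP.
Qed.

(** Only arms below their floor are pulled, so no count exceeds its floor; the counts add up to
    [mandatory b], the sum of the floors, so all are equalities. *)
Lemma mandatory_phase_pulls (b : 'I_(nblocks I)) i :
  pulls (take (mandatory b) (drop (block_start b) h)) i = floor_req I b i.
Proof.
set s := drop (block_start b) h.
have bT := block_end_le_horizon I b; have mb := mandatory_le I b.
have sz : (mandatory b <= size s)%N by rewrite size_drop size_h; lia.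
have pulls_le k : (k <= mandatory b)%N ->
    forall j, (pulls (take k s) j <= floor_req I b j)%N.
  elim: k => [|k IHk] km j; first by rewrite take0.
  rewrite (take_nth q0) ?(leq_trans km)// pulls_rcons.
  case: eqP => [<-|_]; last by rewrite addn0 IHk// ltnW.
  have kT : (block_start b + k < horizon I)%N by lia.
  have szk : size (take (block_start b + k) h) = (block_start b + k)%N.
    by rewrite size_takel// size_h ltnW.
  have := bdq_arm_nth _ kT; rewrite /bdq_arm szk.
  rewrite block_of_round_start ?(leq_trans km)// addKn km.
  rewrite /block_pulls [(_ + k)%N]addnC -take_drop take_oversize; last first.
    by rewrite size_take_min; lia.
  by rewrite /arm [(k + _)%N]addnC -nth_drop addn1.
have : (\sum_(j < K) (floor_req I b j - pulls (take (mandatory b) s) j) == 0)%N.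
  rewrite sumnB => [|j _]; last exact: pulls_le.
  by rewrite sum_pulls_size size_takel// subnn.
rewrite sum_nat_eq0 => /forallP/(_ i) /=; rewrite subn_eq0 => ge.
by apply/eqP; rewrite eqn_leq pulls_le.
Qed.

Lemma floor_req_le_block_pulls (b : 'I_(nblocks I)) i :
  (floor_req I b i <= block_pulls b h i)%N.
Proof.
rewrite -mandatory_phase_pulls /block_pulls.
rewrite -[X in (_ <= pulls X _)%N](cat_take_drop (mandatory b)).
rewrite take_takel ?mandatory_le//.
by rewrite pulls_cat leq_addr.
Qed.

Lemma sum_mandatory_arms (V : nmodType) (g : 'I_K -> V) :
  \sum_(0 <= t < horizon I | ~~ residual_round I t) g (arm t) =
  \sum_(b < nblocks I) \sum_(i < K) g i *+ floor_req I b i.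
Proof.
rewrite sum_mandatory_rounds; apply: eq_bigr => b _.
under [RHS]eq_bigr do rewrite -mandatory_phase_pulls.
have bT := block_end_le_horizon I b; have mb := mandatory_le I b.
rewrite -sum_pulls (big_nth q0) size_takel; last by rewrite size_drop size_h; lia.
apply: eq_big_seq => k; rewrite mem_index_iota => /andP[_ km].
by rewrite nth_take// nth_drop.
Qed.

Lemma sum_arms (V : nmodType) (g : 'I_K -> V) :
  \sum_(q <- h) g q.1 = \sum_(0 <= t < horizon I) g (arm t).
Proof. by rewrite (big_nth q0) size_h. Qed.

End BDQPath.

(** * Summing confidence widths over residual pulls *)

Section ResidualPulls.
Context {R : realType} {K : nat}.
Variables (arm : nat -> 'I_K) (res : pred nat).

Definition residual_pulls T i : nat :=
  (\sum_(0 <= t < T | res t) (arm t == i))%N.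

Lemma sum_residual_pulls T :
  (\sum_(i < K) residual_pulls T i = \sum_(0 <= t < T | res t) 1)%N.
Proof.
rewrite exchange_big /=; apply: eq_bigr => t _.
rewrite (bigD1 (arm t))//= eqxx big1// => i /negPf.
by rewrite eq_sym => ->.
Qed.

(** The difference of roots is [1 / (sqrt (n + 1) + sqrt n)], and [n + 1 <= 4 max(N, 1)] bounds this
    denominator by [4 sqrt (max(N, 1))]. *)
Lemma invr_sqrt_le_diff (N n : nat) : (n <= N)%N ->
  (Num.sqrt (maxn N 1)%:R)^-1 <= 4 * (Num.sqrt n.+1%:R - Num.sqrt n%:R) :> R.
Proof.
move=> nN; set a := Num.sqrt (maxn N 1)%:R.
set x := Num.sqrt n.+1%:R; set y := Num.sqrt n%:R.
have a0 : 0 < a by rewrite sqrtr_gt0 ltr0n; lia.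
have x0 : 0 < x by rewrite sqrtr_gt0 ltr0n.
have y0 : 0 <= y by exact: sqrtr_ge0.
have yx : y <= x by rewrite ler_sqrt// ler_nat.
have xa : x <= 2 * a.
  have -> : 2 * a = Num.sqrt (4 * maxn N 1)%:R.
    rewrite natrM sqrtrM//; congr (_ * _).
    by rewrite (_ : 4%:R = 2 ^+ 2 :> R) ?sqrtr_sqr ?ger0_norm// -natrX.
  by rewrite ler_sqrt// ler_nat; lia.
have xy : (x - y) * (x + y) = 1.
  by rewrite -subr_sqr !sqr_sqrtr// -natr1; ring.
have -> : x - y = (x + y)^-1.
  by apply: (mulIf (lt0r_neq0 (ltr_wpDr y0 x0))); rewrite xy mulVf// gt_eqF// ltr_wpDr.
rewrite ler_pdivlMr ?ltr_wpDr// ler_pdivrMl//.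
by move: xa yx; lra.
Qed.

(** Each residual pull raises only its own arm's root on the right, by enough to pay for its term.
    [N t] will be the total pull count, which mandatory pulls enlarge. *)
Lemma sum_invr_sqrt_le (N : nat -> nat) T :
  (forall t, (t < T)%N -> (residual_pulls t (arm t) <= N t)%N) ->
  \sum_(0 <= t < T | res t) (Num.sqrt (maxn (N t) 1)%:R)^-1 <=
  4 * \sum_(i < K) Num.sqrt (residual_pulls T i)%:R :> R.
Proof.
elim: T => [|T IHT] HN.
  by rewrite big_geq// mulr_ge0// sumr_ge0.
have IH : \sum_(0 <= t < T | res t) (Num.sqrt (maxn (N t) 1)%:R)^-1 <=
    4 * \sum_(i < K) Num.sqrt (residual_pulls T i)%:R :> R.
  by apply: IHT => t tT; rewrite HN// ltnW.
rewrite big_mkcond big_nat_recr//= -big_mkcond/=.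
have rS i : residual_pulls T.+1 i = (residual_pulls T i + res T * (arm T == i))%N.
  rewrite /residual_pulls big_mkcond big_nat_recr//= -big_mkcond/=.
  by case: (res T); rewrite ?mul1n ?mul0n.
under [in leRHS]eq_bigr do rewrite rS.
case: (res T); last first.
  by rewrite addr0; under [in leRHS]eq_bigr do rewrite mul0n addn0; exact: IH.
have -> : \sum_(i < K) Num.sqrt (residual_pulls T i + true * (arm T == i))%:R =
    \sum_(i < K) Num.sqrt (residual_pulls T i)%:R +
    (Num.sqrt (residual_pulls T (arm T)).+1%:R -
     Num.sqrt (residual_pulls T (arm T))%:R) :> R.
  rewrite (bigD1 (arm T))//= [in RHS](bigD1 (arm T))//= eqxx mul1n addn1.
  rewrite addrAC [X in _ = X + _]addrC subrK; congr (_ + _); apply: eq_bigr => i.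
  by rewrite eq_sym => /negPf->; rewrite muln0 addn0.
by rewrite mulrDr lerD// invr_sqrt_le_diff// HN.
Qed.

Lemma sum_sqrt_le (n : 'I_K -> nat) (r : nat) : (0 < K)%N -> (0 < r)%N ->
  (\sum_(i < K) n i = r)%N ->
  \sum_(i < K) Num.sqrt (n i)%:R <= Num.sqrt (K * r)%:R :> R.
Proof.
move=> K0 r0 nr; set s : R := Num.sqrt (K * r)%:R.
have s0 : 0 < s by rewrite sqrtr_gt0 ltr0n muln_gt0 K0.
have s2 : s ^+ 2 = K%:R * r%:R by rewrite sqr_sqrtr ?ler0n// natrM.
have K0R : 0 < K%:R :> R by rewrite ltr0n.
(* AM-GM: [2 sqrt (K n_i) sqrt r <= K n_i + r], summed over the arms. *)
have amgm i : Num.sqrt (n i)%:R <= (K%:R * (n i)%:R + r%:R) / (2 * s).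
  rewrite ler_pdivlMr ?mulr_gt0//.
  set x := Num.sqrt (n i)%:R.
  have -> : (n i)%:R = x ^+ 2 :> R by rewrite sqr_sqrtr.
  rewrite -(ler_pM2l K0R).
  have := sqr_ge0 (K%:R * x - s); rewrite sqrrB s2 exprMn.
  rewrite !mulr2n !expr2; nra.
apply: (le_trans (ler_sum _ (fun i _ => amgm i))).
rewrite -mulr_suml big_split /= -mulr_sumr -natr_sum nr sumr_const card_ord.
rewrite -[r%:R *+ K]mulr_natl -s2; rewrite le_eqVlt; apply/orP; left.
by apply/eqP; field; rewrite gt_eqF.
Qed.

End ResidualPulls.

(** * One residual round: optimism and failure weights *)

Section UCBRound.
Context {R : realType} {K : nat}.
Variables (mu : 'I_K -> R) (L : R).
Hypotheses (mu01 : mean_vector mu) (L_ge : 1 / 2 <= L).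
Implicit Types (h : history R K) (i j : 'I_K).

Definition ucb_width (n : nat) : R := Num.sqrt (2 * L / n%:R).

(* By Markov's inequality, its mean bounds the probability that a confidence
   interval of level [L] fails at a given round before [T]. The slope [2 w_n] is
   the optimal one for [n] pulls, see [reward_weight_ge]. *)
Definition failure_weight (T : nat) h : R :=
  expR (- (2 * L)) * \sum_(i < K) \sum_(1 <= n < T.+1)
    (reward_weight mu (2 * ucb_width n) i h +
     reward_weight mu (- (2 * ucb_width n)) i h).

Lemma failure_weight_martingale T : linear_martingale mu (failure_weight T).
Proof.
apply/linear_martingaleZ/linear_martingale_sum => i.
apply/linear_martingale_sum => n.
by apply: linear_martingaleD; exact: reward_weight_martingale.
Qed.

Lemma failure_weight_ge0 T h : all (fun q => 0 <= q.2 <= 1) h ->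
  0 <= failure_weight T h.
Proof.
move=> h01; rewrite mulr_ge0 ?expR_ge0// sumr_ge0// => i _.
by rewrite sumr_ge0// => n _; rewrite addr_ge0// reward_weight_ge0.
Qed.

Lemma failure_weight_nil T :
  failure_weight T [::] = expR (- (2 * L)) * (2 * K * T)%:R.
Proof.
rewrite /failure_weight; congr (_ * _).
under eq_bigr do under eq_bigr do rewrite /reward_weight !big_nil.
under eq_bigr do rewrite sumr_const_nat subn1 /=.
rewrite sumr_const card_ord -mulrnA -mulr_natl !natrM; ring.
Qed.

(** With slope [2 w] or [- 2 w], by the sign of the deviation, the exponent in [reward_weight_ge] is
    at least [2 w^2 n - w^2 n = 2 L], which cancels [e^(-2 L)]. *)
Lemma failure_weight_ge1 T h i :
  all (fun q => 0 <= q.2 <= 1) h -> (0 < pulls h i <= T)%N ->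
  ucb_width (pulls h i) <= `|empirical_mean h i - mu i| ->
  1 <= failure_weight T h.
Proof.
move=> h01 /andP[n0 nT]; set n := pulls h i in n0 nT *; set w := ucb_width n => wdev.
have nR : 0 < n%:R :> R by rewrite ltr0n.
have w0 : 0 <= w by exact: sqrtr_ge0.
have w2 : w ^+ 2 * n%:R = 2 * L.
  rewrite sqr_sqrtr; first by field; rewrite gt_eqF.
  by rewrite divr_ge0// mulr_ge0//; move: L_ge; lra.
have rw0 l j : 0 <= reward_weight mu l j h by exact: reward_weight_ge0.
have weight_ge (l : R) : l ^+ 2 = 4 * w ^+ 2 ->
    2 * w ^+ 2 <= l * (empirical_mean h i - mu i) ->
    expR (2 * L) <= reward_weight mu l i h.
  move=> l2 ldev; apply: le_trans (reward_weight_ge mu mu01 l i h h01).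
  rewrite ler_expR l2 -/n -w2.
  have -> : \sum_(q <- h | q.1 == i) q.2 - mu i * n%:R =
      (empirical_mean h i - mu i) * n%:R.
    by rewrite /empirical_mean -/n; field; rewrite gt_eqF.
  rewrite mulrA.
  have := ler_wpM2r (ltW nR) ldev; lra.
have : expR (2 * L) <=
    reward_weight mu (2 * w) i h + reward_weight mu (- (2 * w)) i h.
  move: wdev; rewrite ler_normr => /orP[dev|dev].
  - apply: (le_trans (weight_ge (2 * w) _ _)); last by rewrite lerDl.
      by rewrite exprMn; ring.
    by have := ler_wpM2l w0 dev; rewrite expr2; lra.
  - apply: (le_trans (weight_ge (- (2 * w)) _ _)); last by rewrite lerDr.
      by rewrite sqrrN exprMn; ring.
    by have := ler_wpM2l w0 dev; rewrite expr2; lra.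
move=> big; rewrite /failure_weight expRN mulrC ler_pdivlMr ?expR_gt0// mul1r.
apply: (le_trans big).
rewrite (bigD1 i)//= (bigD1_seq n)/= ?mem_index_iota ?n0 ?iota_uniq//.
rewrite -addrA lerDl addr_ge0// sumr_ge0// => [m _|j _].
  exact: addr_ge0.
by apply: sumr_ge0 => m _; exact: addr_ge0.
Qed.

(** A failure weight of at least 1 covers the gap by itself. Otherwise the intervals of all pulled
    arms hold, and optimism gives [mu best <= U_best <= U_a <= mu a + 2 w]. *)
Lemma ucb_gap_le (I : fair_instance K) (eta : R) h (a best : 'I_K) :
  bdq_log I eta = L -> all (fun q => 0 <= q.2 <= 1) h ->
  (size h <= horizon I)%N ->
  (ucb_index I eta h best <= ucb_index I eta h a)%E ->
  mu best - mu a <= 2 * Num.sqrt (2 * L) / Num.sqrt (maxn (pulls h a) 1)%:R +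
                    failure_weight (horizon I) h.
Proof.
move=> LE h01 hT; set T := horizon I.
have gap1 : mu best - mu a <= 1.
  by have /andP[_ ?] := mu01 best; have /andP[? _] := mu01 a; lra.
have width0 : 0 <= 2 * Num.sqrt (2 * L) / Num.sqrt (maxn (pulls h a) 1)%:R.
  by rewrite divr_ge0 ?mulr_ge0 ?sqrtr_ge0.
have [fail _|ok] := leP 1 (failure_weight T h).
  by apply: (le_trans gap1); rewrite -[leLHS]add0r lerD.
have dev i : (0 < pulls h i)%N ->
    `|empirical_mean h i - mu i| < ucb_width (pulls h i).
  move=> n0; rewrite ltNge; apply: contraTN ok => /failure_weight_ge1.
  by rewrite -leNgt; apply => //; rewrite n0 (leq_trans (pulls_le_size h i)).
have FW0 := failure_weight_ge0 T h h01.
(* If [a] was never pulled, the [maxn] with 1 leaves the bound [2 sqrt (2 L) >= 2], as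
   [L >= 1/2]. *)
rewrite /ucb_index LE; case: (posnP (pulls h a)) => [-> _|na].
  rewrite max0n sqrtr1 divr1.
  have : 1 <= Num.sqrt (2 * L).
    by rewrite -[leLHS]sqrtr1 ler_sqrt; move: L_ge; lra.
  move: FW0 gap1; lra.
case: (posnP (pulls h best)) => [_|nb]; first by rewrite leye_eq.
rewrite lee_fin -/(ucb_width _) -/(ucb_width _) (maxn_idPl na).
have := dev _ na; have := dev _ nb; rewrite !ltr_norml => /andP[db _] /andP[_ da].
have -> : 2 * Num.sqrt (2 * L) / Num.sqrt (pulls h a)%:R = 2 * ucb_width (pulls h a).
  rewrite /ucb_width (@sqrtrM _ (2 * L)); last by move: L_ge; lra.
  by rewrite sqrtrV// mulrA.
move: FW0 db da; lra.
Qed.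

End UCBRound.

Lemma pulls_take (R : realType) K (h : history R K) q0 t i :
  (t <= size h)%N ->
  pulls (take t h) i = (\sum_(0 <= s < t) ((nth q0 h s).1 == i))%N.
Proof.
elim: t => [|t IHt] th; first by rewrite take0 big_geq.
by rewrite (take_nth q0)// pulls_rcons IHt ?(ltnW th)// big_nat_recr.
Qed.

(** * Regret of BDQ-UCB *)

Section BDQRegret.
Context {R : realType} {K : nat}.
Variables (I : fair_instance K) (eta : R) (pi : policy R K).
Hypotheses (K_ge2 : (2 <= K)%N) (budget_ge : (K <= residual_budget I)%N).
Hypotheses (eta01 : 0 < eta < 1) (pi_bdq : bdq_ucb I eta pi).
Variable mu : 'I_K -> R.
Hypothesis mu01 : mean_vector mu.

Let T := horizon I.
Let L := bdq_log I eta.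
Let r := residual_budget I.

Let rT : (r <= T)%N. Proof. exact: residual_budget_le_horizon. Qed.
Let K0 : (0 < K)%N. Proof. exact: leq_trans K_ge2. Qed.

Let x := (2 * K * T)%:R / eta.

Let x_ge : (2 * K * T)%:R <= x.
Proof.
case/andP: eta01 => e0 e1; rewrite /x ler_pdivlMr// ler_piMr// ltW//.
Qed.

Let x_gt0 : 0 < x.
Proof.
by apply: lt_le_trans x_ge; rewrite ltr0n !muln_gt0 K0 (leq_trans _ rT)// (leq_trans K0).
Qed.

Lemma bdq_log_ge : 1 / 2 <= L.
Proof.
have x8 : 8 <= x.
  apply: le_trans x_ge; rewrite ler_nat.
  have : (2 <= T)%N by apply: leq_trans rT; apply: leq_trans budget_ge.
  by move: K_ge2; nia.
have : ln x^-1 <= x^-1 - 1.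
  by rewrite -[X in ln X](addrNK 1) addrC le_ln1Dx// ltrBrDr addNr invr_gt0.
rewrite lnV ?posrE// -/L.
have : x^-1 <= 8^-1 by rewrite lef_pV2 ?posrE.
by rewrite -[ln x]/L; lra.
Qed.

(** [e^(-2 L) = x^(-2)] and [2 K T = eta x], so the product is [r eta / x], and [x >= 2 K T >= r].
    The exponent [2 L] leaves room for summing over [r] rounds. *)
Lemma failure_weight_budget_le :
  r%:R * failure_weight mu L T [::] <= 1.
Proof.
rewrite failure_weight_nil expRN (_ : 2 * L = L + L); last by ring.
rewrite expRD -[L]/(ln x) lnK ?posrE//.
have /andP[e0 e1] := eta01.
have xe : (2 * K * T)%:R = x * eta by rewrite /x; field; rewrite gt_eqF.
rewrite xe (_ : _ * _ = r%:R * eta / x); last by field; rewrite gt_eqF.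
rewrite ler_pdivrMr// mul1r; apply: le_trans x_ge.
apply: (@le_trans _ _ r%:R); first by rewrite ler_piMr// ltW.
by rewrite ler_nat (leq_trans rT)// leq_pmull// muln_gt0.
Qed.

Let exists_best : exists best, (forall j, mu j <= mu best) /\ mu_star mu = mu best
  /\ gap mu best = 0.
Proof.
have [best _ max] := @Order.TotalTheory.arg_maxP _ _ _ (Ordinal K0) xpredT mu isT.
have E : mu_star mu = mu best.
  by apply: mu_starE => [|j]; [case/andP: (mu01 best) | exact: max].
by exists best; split; [move=> j; exact: max|rewrite /gap E subrr].
Qed.

Let optE : opt I mu = T%:R * mu_star mu -
  \sum_(b < nblocks I) \sum_(i < K) gap mu i *+ floor_req I b i.
Proof.
rewrite /opt; congr (_ - _); apply: eq_bigr => b _; rewrite big_mkcond.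
apply: eq_bigr => i _; case: eqP => [Ei|_]; last by rewrite mulr_natl.
move: Ei; rewrite /best_arm; case: pickP => // i' /forallP max [->].
rewrite /gap (mu_starE mu i') ?subrr ?mul0rn//.
by case/andP: (mu01 i').
Qed.

(** The mandatory phases cost exactly what [opt] deducts, so only the gaps of residual rounds
    remain. The 8 is the 2 of [ucb_gap_le] times the 4 of [sum_invr_sqrt_le]. *)
Lemma bdq_path_regret_le h : size h = T -> reachable pi h ->
  opt I mu - total_mean mu h <= 8 * Num.sqrt (2 * L) * Num.sqrt (K * r)%:R +
  \sum_(0 <= t < T | residual_round I t) failure_weight mu L T (take t h).
Proof.
move=> sz hr; have [best [max [star gap0]]] := exists_best.
pose q0 : 'I_K * R := (Ordinal K0, 0); pose arm t := (nth q0 h t).1.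
have -> : opt I mu - total_mean mu h =
    \sum_(0 <= t < T | residual_round I t) gap mu (arm t).
  rewrite optE -(sum_mandatory_arms I eta pi pi_bdq h q0)//.
  have -> : total_mean mu h = T%:R * mu_star mu - \sum_(q <- h) gap mu q.1.
    rewrite /gap sumrB big_const_seq count_predT iter_addr_0 sz mulr_natl.
    by rewrite subKr.
  rewrite (sum_arms I h q0)// (bigID (residual_round I) xpredT)/=.
  rewrite -/T; set A := \sum_(0 <= t < T | residual_round I t) _.
  rewrite [X in _ - X - _](_ : _ =
    \sum_(0 <= t < T | ~~ residual_round I t) gap mu (arm t))//.
  by rewrite -/(arm _); ring.
apply: (@le_trans _ _ (\sum_(0 <= t < T | residual_round I t)
   (2 * Num.sqrt (2 * L) * (Num.sqrt (maxn (pulls (take t h) (arm t)) 1)%:R)^-1 +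
    failure_weight mu L T (take t h)))).
  rewrite big_nat_cond [leRHS]big_nat_cond; apply: ler_sum => t.
  case/andP => /andP[_ tT] rt; rewrite /gap star.
  apply: ucb_gap_le => //; first exact: bdq_log_ge.
  - case: hr => [/allP h01 _]; apply/allP => q /mem_take; exact: h01.
  - by rewrite size_take_min (leq_trans (geq_minl _ _))// ltnW.
  - exact: (residual_round_index_le I eta pi pi_bdq h q0 sz hr).
rewrite big_split lerD2r /= -mulr_sumr.
rewrite -[8](_ : 2 * 4 = 8 :> R); last by ring.
rewrite -!mulrA [4 * _]mulrCA ler_wpM2l// ler_wpM2l ?sqrtr_ge0//.
apply: (@le_trans _ _ (4 * \sum_(i < K)
   Num.sqrt (residual_pulls arm (residual_round I) T i)%:R)).
  apply: sum_invr_sqrt_le => t tT.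
  rewrite (pulls_take _ _ _ q0) ?sz ?(ltnW tT)// /residual_pulls big_mkcond.
  by apply: leq_sum => s _; case: ifP.
rewrite ler_wpM2l// sum_sqrt_le//; first by rewrite (leq_trans K0).
by rewrite sum_residual_pulls count_residual_rounds.
Qed.

(** The summed failure weights [G] form a linear martingale, so the pathwise bound passes to the
    mean with [G [::] <= 1] as the only loss. *)
Lemma bdq_regret_le (nu : reward_laws R K) : has_means nu mu ->
  (fair_regret I mu nu pi <=
    (8 * Num.sqrt (2 * L) * Num.sqrt (K * r)%:R + 1)%:E)%E.
Proof.
move=> nu_mu.
set D := 8 * Num.sqrt (2 * L) * Num.sqrt (K * r)%:R.
pose G h := \sum_(0 <= t < T | residual_round I t) failure_weight mu L T (take t h).
have G_nil : G [::] <= 1.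
  apply: le_trans failure_weight_budget_le.
  rewrite /G (eq_bigr (fun=> failure_weight mu L T [::]))//.
  rewrite -big_filter big_const_seq iter_addr_0 count_predT -[leLHS]mulr_natl.
  by rewrite size_filter -sum1_count count_residual_rounds.
have mG : linear_martingale mu G.
  apply: linear_martingale_sum => t.
  exact/linear_martingale_take/failure_weight_martingale.
have tm0 h : 0 <= total_mean mu h.
  by apply: sumr_ge0 => q _; case/andP: (mu01 q.1).
have path h : size h = T -> reachable pi h ->
    opt I mu - D - G h <= total_mean mu h.
  by move=> sz hr; have := bdq_path_regret_le h sz hr; rewrite -/D -/(G h); lra.
have reach0 : reachable pi [::] by split => // h1 i y h2; case: h1.
have := expectation_ge_martingale mu nu pi _ G (opt I mu - D) T [::]
  nu_mu mG tm0 path reach0.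
move=> E; rewrite /fair_regret; apply: le_trans (leeB (lexx _) E) _.
by rewrite -EFinB lee_fin; lra.
Qed.

End BDQRegret.

Theorem theorem4 (R : realType) :
  (exists c : R, 0 < c /\
    forall K r : nat, (2 <= K)%N -> (K <= r)%N ->
    exists I : fair_instance K, residual_budget I = r /\
      forall pi : policy R K, blockwise_fair I pi ->
        ((c * Num.sqrt (K * r)%:R)%:E <= worst_fair_regret I pi)%E) /\
  (exists C : R, 0 < C /\
    forall K r : nat, (2 <= K)%N -> (K <= r)%N ->
    forall eta : R, 0 < eta < 1 ->
    forall I : fair_instance K, residual_budget I = r ->
    forall pi : policy R K, bdq_ucb I eta pi ->
      blockwise_fair I pi /\
      forall (mu : 'I_K -> R) (nu : reward_laws R K),
        mean_vector mu -> has_means nu mu ->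
        (fair_regret I mu nu pi <=
          (C * Num.sqrt (bdq_log I eta))%:E * minimax_fair_regret K r)%E).
Proof.
split.
  exists (5 / 384); split; first by lra.
  move=> K r K2 Kr; exists (single_block_instance K r).
  split=> [|pi _]; first exact: residual_single_block.
  exact: minimax_lower_bound.
(* 13 is 8 times [3/2 >= sqrt 2], plus the additive 1, absorbed by [l * s >= 1]; [384/5] inverts the
   lower-bound constant. *)
exists (13 * (384 / 5)); split; first by lra.
move=> K r K2 Kr eta eta01 I Ir pi pi_bdq; rewrite -Ir in Kr *.
have K0 : (0 < K)%N by apply: leq_trans K2.
split=> [h sz hr b i|mu nu mu01 nu_mu].
  exact: (floor_req_le_block_pulls I eta pi pi_bdq h (Ordinal K0, 0) sz hr).
have Lge := bdq_log_ge I eta K2 Kr eta01.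
apply: (le_trans (bdq_regret_le I eta pi K2 Kr eta01 pi_bdq mu mu01 nu nu_mu)).
move: (residual_budget I) Kr Lge => {Ir}r' Kr'; set L := bdq_log I eta => Lge.
set s := Num.sqrt (K * r')%:R; set l := Num.sqrt L.
have l0 : 0 <= l by exact: sqrtr_ge0.
have s0 : 0 <= s by exact: sqrtr_ge0.
(* Whatever [I] is, the minimax value is bounded below through the single-block instance of the same
   budget. *)
apply: (@le_trans _ _ ((13 * (384 / 5) * l)%:E * (5 / 384 * s)%:E)%E); last first.
  apply: lee_wpmul2l; first by rewrite lee_fin; nra.
  apply: (@le_trans _ _ (ereal_inf [set worst_fair_regret
      (single_block_instance K r') p | p in
      @blockwise_fair R K (single_block_instance K r')]%classic)); last first.
    apply: ereal_sup_ubound; exists (single_block_instance K r') => //=.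
    exact: residual_single_block.
  by apply: le_ereal_inf_tmp => _ [p _ <-]; exact: minimax_lower_bound.
rewrite -EFinM lee_fin.
have s2l : Num.sqrt (2 * L) <= 3 / 2 * l.
  rewrite sqrtrM// ler_wpM2r//.
  rewrite -(@ler_pXn2r _ 2) ?nnegrE ?sqrtr_ge0// sqr_sqrtr// expr2; lra.
have ls : 1 <= l * s.
  rewrite /l /s -sqrtrM; last by move: Lge; lra.
  rewrite -[leLHS]sqrtr1 ler_sqrt; last first.
    by rewrite mulr_ge0 ?ler0n//; move: Lge; lra.
  have : 4 <= (K * r')%:R :> R by rewrite ler_nat; nia.
  by move: Lge; nra.
have := ler_wpM2r s0 s2l.
have -> : 13 * (384 / 5) * l * (5 / 384 * s) = 13 * (l * s) by field.
by move: ls; lra.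
Qed.
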